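(* Let $k_1,\ldots,k_n$ be nonnegative integers whose sum is $m$. Then for any real Banach space $X$ $$\mathbb{R}(k_1,\ldots,k_n;X)\le\sqrt{\frac{m^m}{k_1^{k_1}\cdots k_n^{k_n}}}.$$
   Context: Let $X$ be a real Banach space with closed unit ball $B_X$. $\mathcal{L}^s({}^mX;\mathbb{R})$ denotes the space of continuous symmetric $m$-linear forms $L:X^m\to\mathbb{R}$. For such $L$, $\widehat{L}(x)=L(x,\ldots,x)$ and $\|\widehat{L}\|=\sup_{x\in B_X}|\widehat{L}(x)|$. For nonnegative integers $k_1,\ldots,k_n$ with sum $m\ge1$, $L(x_1^{k_1}\ldots x_n^{k_n})$ denotes the value of $L$ with $x_i$ placed in $k_i$ of the coordinates. Define $$\mathbb{R}(k_1,\ldots,k_n;X)=\inf\Big\{M>0:\ \sup_{x_1,\ldots,x_n\in B_X}|L(x_1^{k_1}\ldots x_n^{k_n})|\le M\|\widehat{L}\|\ \ \forall L\in\mathcal{L}^s({}^mX;\mathbb{R})\Big\}.$$ Convention: $0^0=1$. *)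

(* Defs.v *)
From HB Require Import structures.
From mathcomp Require Import all_boot all_order all_algebra all_fingroup.
From mathcomp Require Import all_classical all_reals all_analysis.

Set Implicit Arguments.
Unset Strict Implicit.
Unset Printing Implicit Defensive.

Import Order.TTheory GRing.Theory Num.Theory.
Import numFieldNormedType.Exports.

Local Open Scope classical_set_scope.
Local Open Scope ring_scope.

Section PolarizationConstant.
Context {R : realType} (X : completeNormedModType R).

(* [dfwith x i u] is the tuple [x] with its [i]-th coordinate replaced by [u]. *)
Definition multilinear_form (m : nat) (L : ('I_m -> X) -> R) : Prop :=
  forall (i : 'I_m) (x : 'I_m -> X), scalar (fun u : X => L (dfwith x i u)).

Definition multisymmetric (m : nat) (L : ('I_m -> X) -> R) : Prop :=
  forall (s : 'S_m) (x : 'I_m -> X), L (x \o s) = L x.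

(* [{ptws 'I_m -> X}] is [X^m] with the product topology. *)
Definition cont_sym_forms (m : nat) : set (('I_m -> X) -> R) :=
  [set L | [/\ multilinear_form L, multisymmetric L &
               continuous (L : {ptws 'I_m -> X} -> R)]].

Definition unit_ball : set X := [set x | `|x| <= 1].

Definition diag_poly (m : nat) (L : ('I_m -> X) -> R) (x : X) : R :=
  L (fun=> x).

(* Suprema and infima are taken in [\bar R], so that no default value can
   interfere. *)
Definition poly_norm (P : X -> R) : \bar R :=
  ereal_sup [set `|P x|%:E | x in unit_ball].

(* [tagnat.sig1 j] is the index of the block containing [j] when
   [0, \sum_i k i) is cut into consecutive blocks of lengths [k 0], [k 1], ...;
   hence this is L(x_1^{k_1} ... x_n^{k_n}). *)
Definition eval_blocks (n : nat) (k : 'I_n -> nat)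
    (L : ('I_(\sum_(i < n) k i)%N -> X) -> R) (x : 'I_n -> X) : R :=
  L (fun j => x (tagnat.sig1 j)).

Definition polarization_bound (n : nat) (k : 'I_n -> nat) (M : R) : Prop :=
  forall L : ('I_(\sum_(i < n) k i)%N -> X) -> R,
    cont_sym_forms L ->
    (ereal_sup [set `|eval_blocks L x|%:E
               | x in [set x : 'I_n -> X | forall i, unit_ball (x i)]]
     <= M%:E * poly_norm (diag_poly L))%E.

Definition polarization_constant (n : nat) (k : 'I_n -> nat) : \bar R :=
  ereal_inf [set M%:E | M in [set M : R | 0 < M /\ polarization_bound k M]].

End PolarizationConstant.

(* Main.v *)
Require Import Defs.
From HB Require Import structures.
From mathcomp Require Import all_boot all_order all_algebra all_fingroup.
From mathcomp Require Import all_classical all_reals all_analysis.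
From mathcomp Require Import ring lra.

Set Implicit Arguments.
Unset Strict Implicit.
Unset Printing Implicit Defensive.

Import Order.TTheory GRing.Theory Num.Theory.
Import numFieldNormedType.Exports.

Local Open Scope ring_scope.

(** The idea is to compare [X] with a Euclidean space in which every symmetric
    form is already bounded by its diagonal.

    Fix [x_1, ..., x_n] in the unit ball of [X], put [w_i = k_i / m], so that
    the [w_i] are nonnegative with sum 1, and let [T : R^n -> X] send [a] to
    [\sum_i a_i sqrt(w_i) x_i].  By Cauchy-Schwarz, in the form
    [|a_i| sqrt(w_i) <= (a_i^2 + w_i) / 2], [T] maps the Euclidean unit sphere
    into the unit ball of [X] ([weighted_comb_contraction]).  Hence the diagonal
    of the symmetric form [L o T] is bounded on that sphere by the norm of the
    polynomial of [L].

    On a Euclidean space, a theorem of Banach says that a symmetric form has the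
    same norm as its polynomial ([Banach_symmetric_forms]).  Applied to [L o T]
    at the basis vectors, the [i]-th one being repeated [k_i] times, it bounds
    [\prod_i sqrt(w_i)^{k_i} |L(x_1^{k_1} ... x_n^{k_n})|] by the norm of the
    polynomial of [L] ([block_bound]), and the product of the [w_i^{k_i}] is the
    inverse of [m^m / (k_1^{k_1} ... k_n^{k_n})].

    Banach's theorem is proved by showing that [|L|] attains its maximum over
    tuples of unit vectors at a constant tuple.  By compactness there is,
    among the maximizers, one whose sum is longest.  If two of its entries
    differed, one could replace both by their normalized sum: this remains a
    maximizer by the two-variable case ([bilinear_max_diag]) and makes the sum
    longer ([maximizer_constant]). *)

(* The join of the complete and of the normed structure of row vectors, which
   lets the notions about forms on a Banach space be used for [R^n]. *)
HB.instance Definition _ (R : realType) n := Complete.on 'rV[R]_n.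

(** * The Euclidean sphere *)

Section Dot.
Context {R : realType} {n : nat}.
Implicit Types u v w : 'rV[R]_n.

Definition dot u v : R := \sum_i u 0 i * v 0 i.

Lemma dotC u v : dot u v = dot v u.
Proof. by apply: eq_bigr => i _; rewrite mulrC. Qed.

Lemma dotDl u v w : dot (u + v) w = dot u w + dot v w.
Proof. by rewrite -big_split; apply: eq_bigr => i _; rewrite mxE mulrDl. Qed.

Lemma dotZl a u v : dot (a *: u) v = a * dot u v.
Proof. by rewrite mulr_sumr; apply: eq_bigr => i _; rewrite mxE mulrA. Qed.

Lemma dotDr u v w : dot u (v + w) = dot u v + dot u w.
Proof. by rewrite dotC dotDl !(dotC u). Qed.

Lemma dotZr a u v : dot u (a *: v) = a * dot u v.
Proof. by rewrite dotC dotZl dotC. Qed.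

Lemma dotNl u v : dot (- u) v = - dot u v.
Proof. by rewrite -scaleN1r dotZl mulN1r. Qed.

Lemma dotNr u v : dot u (- v) = - dot u v.
Proof. by rewrite dotC dotNl dotC. Qed.

Definition dotE := (dotDl, dotDr, dotZl, dotZr, dotNl, dotNr).

Lemma dot_ge0 u : 0 <= dot u u.
Proof. by apply: sumr_ge0 => i _; rewrite -expr2 sqr_ge0. Qed.

Lemma dot_eq0 u : dot u u = 0 -> u = 0.
Proof.
move=> /eqP; rewrite psumr_eq0 => [/allP u0|i _]; last by rewrite -expr2 sqr_ge0.
apply/rowP => i; have := u0 i (mem_index_enum _).
by rewrite mulf_eq0 orbb mxE => /eqP.
Qed.

Lemma dot_delta i : dot (delta_mx 0 i) (delta_mx 0 i) = 1.
Proof.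
rewrite /dot (bigD1 i)//= big1 ?mxE ?eqxx ?mulr1 ?addr0// => j /negbTE ji.
by rewrite !mxE ji andbF mul0r.
Qed.

Lemma dot_normalize u : u != 0 ->
  dot ((Num.sqrt (dot u u))^-1 *: u) ((Num.sqrt (dot u u))^-1 *: u) = 1.
Proof.
move=> u0; have uu : dot u u != 0 by apply: contraNneq u0 => /dot_eq0 ->.
rewrite !dotE mulrA -expr2 exprVn sqr_sqrtr ?dot_ge0// mulVf//.
Qed.

Lemma dot_self_continuous : continuous (fun u : 'rV[R]_n => dot u u).
Proof.
apply: continuous_big => [|i _ u]; first exact: add_continuous.
by apply: continuousM; exact: coord_continuous.
Qed.

Lemma sphere_compact : compact [set u : 'rV[R]_n | dot u u = 1].
Proof.
apply: bounded_closed_compact.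
  exists 1; split => // M M1 u /= u1.
  apply: le_trans (ltW M1); rewrite [leLHS]/Num.norm /= mx_normrE.
  apply/bigmax_leP; split => // -[i j] _ /=; rewrite ord1.
  rewrite -(@expr_le1 _ 2)// real_normK ?num_real// -u1.
  by rewrite /dot (bigD1 j)//= -expr2 lerDl sumr_ge0// => l _; rewrite -expr2 sqr_ge0.
apply: (@preimage_closed _ _ (fun u => dot u u) [set x : R | x = 1%R]); last exact: closed_eq.
by move=> u _; exact: dot_self_continuous.
Qed.

End Dot.

(** * Bilinear forms at a maximum *)

Section BilinearMaximum.
Context {R : realType} {n : nat}.

Lemma quadratic_bound_extend (Q : 'rV[R]_n -> R) (M : R) :
  (forall a u, Q (a *: u) = a ^+ 2 * Q u) ->
  (forall u, dot u u = 1 -> `|Q u| <= M) ->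
  forall u, `|Q u| <= M * dot u u.
Proof.
move=> Qhom QM u; have [->|u0] := eqVneq u 0.
  by rewrite -(scale0r (0 : 'rV_n)) Qhom expr0n /= mul0r normr0 dotZl mul0r mulr0.
have := QM _ (dot_normalize u0).
have uu : 0 < dot u u.
  by rewrite lt_neqAle dot_ge0 andbT eq_sym; apply: contraNneq u0 => /dot_eq0 ->.
rewrite Qhom exprVn sqr_sqrtr ?dot_ge0// normrM ger0_norm ?invr_ge0 ?dot_ge0//.
by rewrite mulrC ler_pdivrMr.
Qed.

(** By polarization [4 B(u,v) = B(u+v,u+v) - B(u-v,u-v)], while the two terms on
    the right have absolute value at most [M|u+v|^2] and [M|u-v|^2], which sum to
    [4M].  When [|B(u,v)| = M], both bounds are therefore attained. *)
Lemma bilinear_max_diag (B : 'rV[R]_n -> 'rV[R]_n -> R) (M : R) u v :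
  (forall w, scalar (B w)) -> (forall w z, B w z = B z w) ->
  (forall w, dot w w = 1 -> `|B w w| <= M) ->
  dot u u = 1 -> dot v v = 1 -> `|B u v| = M ->
  `|B (u + v) (u + v)| = M * dot (u + v) (u + v).
Proof.
move=> Blin BC BM u1 v1 Buv.
have BD w x y : B w (x + y) = B w x + B w y.
  by have := Blin w 1 x y; rewrite scale1r mul1r.
have B0 w : B w 0 = 0 by apply: (addrI (B w 0)); rewrite -BD !addr0.
have BZ w a x : B w (a *: x) = a * B w x.
  by have := Blin w a x 0; rewrite B0 !addr0.
have Bhom a w : B (a *: w) (a *: w) = a ^+ 2 * B w w.
  by rewrite BZ BC BZ mulrA expr2.
have Bbd := quadratic_bound_extend Bhom BM.
have := Bbd (u + v); have := Bbd (u - v).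
have BN w x : B w (- x) = - B w x by rewrite -scaleN1r BZ mulN1r.
have BDl w x y : B (x + y) w = B x w + B y w by rewrite BC BD !(BC w).
have BNl w x : B (- x) w = - B x w by rewrite BC BN BC.
rewrite !dotE u1 v1 (dotC v u) !(BD, BN, BDl, BNl) (BC v u).
move=> H1 H2; apply/eqP; rewrite eq_le H2 /=.
move: Buv H1; case: (ler0P (B u v)) => _ Buv; rewrite !ler_norml => /andP[H1 H3].
- by rewrite ler_normr; apply/orP; right; lra.
- by rewrite ler_normr; apply/orP; left; lra.
Qed.

End BilinearMaximum.

(** * Multilinear forms *)

Section Multilinear.
Context {R : realType} {X : completeNormedModType R} {m : nat}.
Implicit Types (L : ('I_m -> X) -> R) (y : 'I_m -> X).

Lemma dfwith_id y i : dfwith y i (y i) = y.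
Proof. by apply/funext => j; case: dfwithP. Qed.

Lemma sum_dfwith y i u : \sum_j dfwith y i u j = \sum_j y j - y i + u.
Proof.
rewrite (bigD1 i)//= [\sum_j y j](bigD1 i)//= dfwithin addrC; congr (_ + _).
rewrite [y i + _]addrC addrK; apply: eq_bigr => j ji.
by rewrite dfwithout// eq_sym.
Qed.

Lemma multilinearZ L y i a u : multilinear_form L ->
  L (dfwith y i (a *: u)) = a * L (dfwith y i u).
Proof.
move=> Llin; have L0 : L (dfwith y i 0) = 0.
  apply: (addIr (L (dfwith y i 0))); rewrite add0r.
  by have := Llin i y 1 0 0; rewrite scale1r addr0 mul1r => <-.
by have := Llin i y a u 0; rewrite L0 !addr0.
Qed.

Lemma multisymmetric_swap L y i j u v : multisymmetric L -> i != j ->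
  L (dfwith (dfwith y i u) j v) = L (dfwith (dfwith y i v) j u).
Proof.
move=> Lsym ij; rewrite -(Lsym (tperm i j)); congr L; apply/funext => l /=.
case: tpermP => [->|->|/eqP li /eqP lj].
- by rewrite dfwithin dfwithout 1?eq_sym// dfwithin.
- by rewrite dfwithin dfwithout 1?eq_sym// dfwithin.
- by rewrite !dfwithout// eq_sym.
Qed.

(** Only one coordinate at a time can be rescaled, so the induction runs over a
    duplicate-free sequence of coordinates already rescaled. *)
Lemma multilinear_scale L (c : 'I_m -> R) y : multilinear_form L ->
  L (fun j => c j *: y j) = (\prod_j c j) * L y.
Proof.
move=> Llin.
suff H (s : seq 'I_m) : uniq s ->
    L (fun j => if j \in s then c j *: y j else y j) = (\prod_(j <- s) c j) * L y.
  have := H _ (index_enum_uniq 'I_m).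
  under [X in L X = _ -> _]funext do rewrite mem_index_enum.
  exact.
elim: s => [|i s IHs] /=; first by rewrite big_nil mul1r.
move=> /andP[nis us]; rewrite big_cons -mulrA -IHs//.
set z := fun j => if j \in s then c j *: y j else y j.
rewrite -[in RHS](dfwith_id z i) -multilinearZ//; congr L; apply/funext => j.
have [<-|ij] := eqVneq i j; first by rewrite dfwithin /z mem_head (negbTE nis).
by rewrite dfwithout// in_cons eq_sym (negbTE ij).
Qed.

End Multilinear.

Lemma continuous_to_ptws {I : Type} {S T : topologicalType}
    (g : S -> I -> T) :
  (forall i, continuous (fun s => g s i)) -> continuous (g : S -> {ptws I -> T}).
Proof.
move=> gcont s; apply/cvg_sup => i.
exact: (@continuous_comp_initial (I -> T) S T (fun f => f i) g (gcont i) s).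
Qed.

Section Composition.
Context {R : realType} {X Y : completeNormedModType R} {m : nat}.

Lemma cont_sym_forms_comp (L : ('I_m -> X) -> R) (T : Y -> X) :
  linear T -> continuous T -> cont_sym_forms L ->
  cont_sym_forms (fun y : 'I_m -> Y => L (T \o y)).
Proof.
move=> Tlin Tcont [Llin Lsym Lcont]; split.
- move=> i y a u v.
  have TE w : T \o dfwith y i w = dfwith (T \o y) i (T w).
    apply/funext => j /=; have [<-|ij] := eqVneq i j; first by rewrite !dfwithin.
    by rewrite !dfwithout.
  by rewrite !TE Tlin Llin.
- by move=> s y; rewrite compA Lsym.
- move=> y; apply: (@continuous_comp {ptws 'I_m -> Y} {ptws 'I_m -> X} R
    (fun y => T \o y) L); last exact: Lcont.
  move: y; apply: continuous_to_ptws => i y.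
  apply: (@continuous_comp {ptws 'I_m -> Y} Y X (fun y => y i) T).
    exact: (@proj_continuous _ (fun=> Y) i).
  exact: Tcont.
Qed.

End Composition.

(** * Banach's theorem on symmetric forms over a Euclidean space *)

Section Banach.
Context {R : realType} {n m : nat}.
Local Notation E := 'rV[R]_n.
Local Open Scope classical_set_scope.

Definition sphere_tuples : set {ptws 'I_m -> E} :=
  [set y | forall i, dot (y i) (y i) = 1].

Lemma sphere_tuples_compact : compact sphere_tuples.
Proof.
exact: (@tychonoff _ (fun=> E) (fun=> [set u | dot u u = 1])
  (fun=> sphere_compact)).
Qed.

Lemma sphere_tuples_dfwith y i u : sphere_tuples y -> dot u u = 1 ->
  sphere_tuples (dfwith y i u).
Proof. by move=> yS u1 j; case: dfwithP. Qed.

Lemma norm_sum_continuous :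
  continuous (fun y : {ptws 'I_m -> E} => dot (\sum_i y i) (\sum_i y i)).
Proof.
move=> y; apply: (@continuous_comp {ptws 'I_m -> E} E R
  (fun y => \sum_i y i) (fun u => dot u u)); last exact: dot_self_continuous.
move: y; apply: continuous_big => [|i _]; first exact: add_continuous.
exact: (@proj_continuous _ (fun=> E) i).
Qed.

(** Two successive maximizations: the maximizers of [|L|] form a compact set, on
    which the length of the sum is then maximized. *)
Lemma maximizer_with_longest_sum (L : ('I_m -> E) -> R) y0 :
  cont_sym_forms L -> sphere_tuples y0 ->
  exists y, [/\ sphere_tuples y, forall z, sphere_tuples z -> `|L z| <= `|L y| &
    forall z, sphere_tuples z -> `|L z| = `|L y| ->
      dot (\sum_i z i) (\sum_i z i) <= dot (\sum_i y i) (\sum_i y i)].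
Proof.
move=> [_ _ Lcont] y0S.
have absLcont : continuous (fun y : {ptws 'I_m -> E} => `|L y|).
  move=> y; apply: (@continuous_comp {ptws 'I_m -> E} R R L Num.norm).
    exact: Lcont.
  exact: norm_continuous.
have [c /set_mem cS cmax] := compact_EVT_max (ex_intro _ y0 y0S)
  sphere_tuples_compact (continuous_subspaceT absLcont).
pose A := sphere_tuples `&` [set y | `|L y| = `|L c|].
have cA : compact A.
  apply: compact_closedI sphere_tuples_compact _.
  apply: (@preimage_closed _ _ (fun y : {ptws 'I_m -> E} => `|L y|)
    [set x : R | x = `|L c|]); last exact: closed_eq.
  by move=> y _; exact: absLcont.
have [y /set_mem[yS /= Ly] ymax] := compact_EVT_max
  (ex_intro _ c (conj cS erefl)) cA (continuous_subspaceT norm_sum_continuous).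
exists y; split => // [z zS|z zS]; rewrite Ly.
  by apply: cmax; exact/mem_set.
by move=> Lz; apply: ymax; apply/mem_set.
Qed.

(** Write [S] for the sum of the tuple and [s = y_i + y_j].  Changing signs of
    entries preserves [|L|], so comparing the length of [S] with that of
    [S - 2 y_i] gives [<y_i, S> >= 1], and with that of [S - 2 s] gives
    [<s, S> >= |s|^2].  The former excludes [s = 0]; then with [z = s / |s|] the
    latter reads [<z, S> >= |s|].  Replacing [y_i] and [y_j] by [z] keeps [|L|]
    maximal and turns [S] into [S + (2 - |s|) z], which is longer than [S] if
    [|s| < 2].  Hence [|s| >= 2], which for unit vectors means [y_i = y_j]. *)
Lemma maximizer_constant (L : ('I_m -> E) -> R) y :
  multilinear_form L -> multisymmetric L ->
  sphere_tuples y -> (forall z, sphere_tuples z -> `|L z| <= `|L y|) ->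
  (forall z, sphere_tuples z -> `|L z| = `|L y| ->
      dot (\sum_i z i) (\sum_i z i) <= dot (\sum_i y i) (\sum_i y i)) ->
  forall i j, y i = y j.
Proof.
move=> Llin Lsym yS Lmax ymax i j; have [->//|ij] := eqVneq i j.
set S := \sum_l y l in ymax.
have flip l z : sphere_tuples z -> sphere_tuples (dfwith z l (- z l)) /\
    `|L (dfwith z l (- z l))| = `|L z|.
  move=> zS; split; first by apply: sphere_tuples_dfwith; rewrite ?dotE ?opprK.
  by rewrite -scaleN1r multilinearZ// dfwith_id mulN1r normrN.
have flip1 l : 1 <= dot (y l) S.
  have [fS fL] := flip l y yS; have := ymax _ fS fL.
  by rewrite sum_dfwith -/S !dotE (dotC S) yS; lra.
have flip2 : dot (y i + y j) (y i + y j) <= dot (y i + y j) S.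
  have [fS fL] := flip i y yS; have [gS gL] := flip j _ fS.
  have := ymax _ gS (etrans gL fL).
  rewrite !sum_dfwith -/S dfwithout// !dotE !(dotC S) (dotC (y j) (y i)) !yS; lra.
pose B u v := L (dfwith (dfwith y i u) j v).
have BC u v : B u v = B v u by exact: multisymmetric_swap.
have Blin u : scalar (B u) by exact: Llin.
have Bij : B (y i) (y j) = L y by rewrite /B !dfwith_id.
have BS u : dot u u = 1 -> sphere_tuples (dfwith (dfwith y i u) j u).
  by move=> u1; do 2![apply: sphere_tuples_dfwith => //].
have Bss := bilinear_max_diag Blin BC (fun u u1 => Lmax _ (BS u u1)) (yS i) (yS j)
  (congr1 Num.norm Bij).
move: (flip1 i) (flip1 j) => fi fj.
set s := y i + y j in flip2 Bss.
have sS : dot s S = dot (y i) S + dot (y j) S by rewrite dotDl.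
have ss : dot s s = 2 + 2 * dot (y i) (y j).
  by rewrite !dotE (dotC (y j)) !yS; ring.
have s0 : s != 0.
  apply/eqP => s0; move: sS; rewrite s0 -(scale0r (0 : E)) dotZl mul0r; lra.
have q0 : 0 < dot s s.
  by rewrite lt_neqAle dot_ge0 andbT eq_sym; apply: contraNneq s0 => /dot_eq0 ->.
set c := Num.sqrt (dot s s).
have c0 : 0 < c by rewrite sqrtr_gt0.
have c2 : c ^+ 2 = dot s s by rewrite sqr_sqrtr// dot_ge0.
pose z := c^-1 *: s.
have z1 : dot z z = 1 by exact: dot_normalize.
have sz : s = c *: z by rewrite scalerA mulfV ?scale1r// gt_eqF.
have Lz : `|L (dfwith (dfwith y i z) j z)| = `|L y|.
  have BZ a u v : B u (a *: v) = a * B u v by exact: multilinearZ.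
  have Bs : B s s = c ^+ 2 * B z z.
    by rewrite sz (BZ c (c *: z) z) (BC (c *: z)) (BZ c z z) mulrA -expr2.
  rewrite -/(B z z); apply: (@mulfI _ (c ^+ 2)); first by rewrite c2 gt_eqF.
  by rewrite -[in LHS](ger0_norm (sqr_ge0 c)) -normrM -Bs Bss c2 mulrC.
have zS : c <= dot z S.
  by rewrite /z dotZl mulrC ler_pdivlMr// -expr2 c2.
clearbody z; have := ymax _ (BS z z1) Lz.
have -> : \sum_l dfwith (dfwith y i z) j z l = S + (2 - c) *: z.
  rewrite !sum_dfwith dfwithout// -/S scalerBl -sz /s scaler_nat mulr2n.
  by apply/rowP => l; rewrite !mxE; ring.
rewrite !dotE z1 (dotC S z) => H.
(* [H] says that [2 (2 - c) <z, S> + (2 - c)^2 <= 0]. *)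
have cge2 : 2 <= c.
  rewrite leNgt; apply/negP => clt2.
  have : 0 < (2 - c) * dot z S by rewrite mulr_gt0// ?subr_gt0// (lt_le_trans c0).
  have : 0 <= (2 - c) * (2 - c) by rewrite -expr2 sqr_ge0.
  lra.
have : 4 <= dot s s by rewrite -c2; nra.
rewrite ss => yij; apply/eqP; rewrite -subr_eq0; apply/eqP/dot_eq0.
(* [|y_i - y_j|^2 + |s|^2 = 4] *)
apply/eqP; rewrite eq_le dot_ge0 andbT !dotE (dotC (y j)) !yS; lra.
Qed.

Lemma Banach_symmetric_forms (L : ('I_m -> E) -> R) (C : R) :
  (0 < m)%N -> cont_sym_forms L ->
  (forall u, dot u u = 1 -> `|diag_poly L u| <= C) ->
  forall y, (forall i, dot (y i) (y i) = 1) -> `|L y| <= C.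
Proof.
move=> m0 Lcsf LC y0 y0S.
have [y [yS Lmax ymax]] := maximizer_with_longest_sum Lcsf y0S.
have [Llin Lsym _] := Lcsf.
apply: le_trans (Lmax _ y0S) _; pose i0 := Ordinal m0.
have -> : y = fun=> y i0 by apply/funext => i; exact: maximizer_constant.
exact/LC/yS.
Qed.

End Banach.

(** * A contraction from a Euclidean space *)

Section Contraction.
Context {R : realType} {X : completeNormedModType R} {n : nat}.
Implicit Types (w : 'I_n -> R) (x : 'I_n -> X).

(** The square roots of the weights are put on the vectors so that the norm on
    the source is the standard Euclidean one; a weight may then vanish. *)
Definition weighted_comb w x (a : 'rV[R]_n) : X :=
  \sum_i (a 0 i * Num.sqrt (w i)) *: x i.

Lemma weighted_comb_linear w x : linear (weighted_comb w x).
Proof.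
move=> c a b; rewrite /weighted_comb scaler_sumr -big_split /=.
by apply: eq_bigr => i _; rewrite !mxE mulrDl scalerDl scalerA mulrA.
Qed.

Lemma weighted_comb_continuous w x : continuous (weighted_comb w x).
Proof.
apply: continuous_big => [|i _ a]; first exact: add_continuous.
apply: (@continuousZr_tmp R X _ (fun a : 'rV[R]_n => a 0 i * Num.sqrt (w i))).
apply: continuousM; last exact: cst_continuous.
exact: coord_continuous.
Qed.

Lemma weighted_comb_delta w x i :
  weighted_comb w x (delta_mx 0 i) = Num.sqrt (w i) *: x i.
Proof.
rewrite /weighted_comb (bigD1 i)//= mxE !eqxx mul1r big1 ?addr0// => j /negbTE ji.
by rewrite mxE ji andbF mul0r scale0r.
Qed.

(** Cauchy-Schwarz with both factors of norm 1, hence obtained from summing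
    [|a_i| sqrt(w_i) <= (a_i^2 + w_i) / 2]. *)
Lemma weighted_comb_contraction w x a :
  (forall i, 0 <= w i) -> \sum_i w i = 1 -> (forall i, `|x i| <= 1) ->
  dot a a = 1 -> `|weighted_comb w x a| <= 1.
Proof.
move=> w0 w1 x1 a1.
have le_term i : `|(a 0 i * Num.sqrt (w i)) *: x i| <= (a 0 i * a 0 i + w i) / 2.
  rewrite normrZ (le_trans (ler_piMr (normr_ge0 _) (x1 i)))//.
  rewrite normrM (ger0_norm (sqrtr_ge0 _)) -[X in _ + X](sqr_sqrtr (w0 i)).
  rewrite -expr2 -(real_normK (num_real (a 0 i))).
  have := sqr_ge0 (`|a 0 i| - Num.sqrt (w i)); nra.
apply: le_trans (ler_norm_sum _ _ _) _.
apply: le_trans (ler_sum _ (fun i _ => le_term i)) _.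
by rewrite -mulr_suml big_split /= -/(dot a a) a1 w1 divff.
Qed.

End Contraction.

(** * The polarization constant *)

Lemma prod_blocks (R : comNzRingType) (n : nat) (k : 'I_n -> nat) (f : 'I_n -> R) :
  \prod_(j < \sum_(i < n) k i) f (tagnat.sig1 j) = \prod_i f i ^+ k i.
Proof.
rewrite (reindex (@tagnat.rank _ k)) /=; last exact/onW_bij/tagnat.rank_bij.
under eq_bigr do rewrite /tagnat.sig1 tagnat.rankK.
rewrite -(@sig_big_dep _ _ _ _ (fun i => 'I_(k i)) predT (fun _ => predT)
  (fun i _ => f i)) /=.
by apply: eq_bigr => i _; rewrite prodr_const card_ord.
Qed.

(** Banach's theorem for the pullback of [L] along [weighted_comb w x], at the
    unit basis vectors.  The weights are kept free here: [w_i = k_i / m] is the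
    choice that maximizes the product of the [w_i^{k_i}]. *)
Lemma block_bound (R : realType) (X : completeNormedModType R) (n : nat)
    (k : 'I_n -> nat) (L : ('I_(\sum_(i < n) k i) -> X) -> R) (w : 'I_n -> R)
    (x : 'I_n -> X) (r : R) :
  (0 < \sum_(i < n) k i)%N -> cont_sym_forms L ->
  (forall i, 0 <= w i) -> \sum_i w i = 1 ->
  (forall u, unit_ball u -> `|diag_poly L u| <= r) ->
  (forall i, unit_ball (x i)) ->
  `|eval_blocks L x| * Num.sqrt (\prod_i w i ^+ k i) <= r.
Proof.
move=> m0 Lcsf w0 w1 Lr x1.
have LTcsf := cont_sym_forms_comp (weighted_comb_linear w x)
  (@weighted_comb_continuous _ _ _ w x) Lcsf.
have := Banach_symmetric_forms (C := r) m0 LTcsf _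
  (fun i => dot_delta (tagnat.sig1 i)).
have -> : weighted_comb w x \o (fun j => delta_mx 0 (tagnat.sig1 j)) =
    (fun j => Num.sqrt (w (@tagnat.sig1 _ k j)) *: x (tagnat.sig1 j)).
  by apply/funext => j; exact: weighted_comb_delta.
rewrite multilinear_scale; last by case: Lcsf.
rewrite (prod_blocks k (fun i => Num.sqrt (w i))) normrM -sqrtr_sqr -prodrXl.
under eq_bigr do rewrite -exprM mulnC exprM sqr_sqrtr//.
rewrite mulrC; apply => u u1.
exact/Lr/weighted_comb_contraction.
Qed.

Theorem proposition14 (R : realType) (X : completeNormedModType R)
    (n m : nat) (k : 'I_n -> nat) (m_gt0 : (0 < m)%N)
    (sum_k : (\sum_(i < n) k i)%N = m) :
  (polarization_constant X k <=
     (Num.sqrt (m%:R ^+ m / \prod_(i < n) (k i)%:R ^+ k i))%:E)%E.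
Proof.
have m0 : 0 < m%:R :> R by rewrite ltr0n.
have pk : 0 < \prod_(i < n) (k i)%:R ^+ k i :> R.
  (* a factor with [k i = 0] is [0 ^+ 0 = 1] *)
  apply: prodr_gt0 => i _; case: (k i) => [|p]; first by rewrite expr0.
  by rewrite exprn_gt0// ltr0n.
set M := Num.sqrt _.
have M0 : 0 < M by rewrite sqrtr_gt0 divr_gt0// exprn_gt0.
apply: ereal_inf_lbound; exists M => //; split => // L Lcsf.
apply: ge_ereal_sup => _ [x /= x1 <-].
have ub u : unit_ball u -> (`|diag_poly L u|%:E <= poly_norm (diag_poly L))%E.
  by move=> u1; apply: ereal_sup_ubound; exists u.
case: (poly_norm _) ub => [r| |] ub; last 2 first.
- by rewrite gt0_muley ?lte_fin// leey.
- by have := ub 0; rewrite /unit_ball /= normr0 ler01 leeNy_eq => /(_ isT).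
rewrite -EFinM lee_fin.
pose w i : R := (k i)%:R / m%:R.
have w0 i : 0 <= w i by rewrite divr_ge0.
have w1 : \sum_i w i = 1 by rewrite -mulr_suml -natr_sum sum_k divff// gt_eqF.
have wk : \prod_i w i ^+ k i = (M ^+ 2)^-1.
  rewrite sqr_sqrtr ?divr_ge0 ?exprn_ge0 ?(ltW pk)// invf_div.
  under eq_bigr do rewrite expr_div_n.
  by rewrite prodf_div prodrXr sum_k.
have m0' : (0 < \sum_(i < n) k i)%N by rewrite sum_k.
have := block_bound m0' Lcsf w0 w1 ub x1.
by rewrite wk -exprVn sqrtr_sqr normfV (gtr0_norm M0) ler_pdivrMr// mulrC.
Qed.
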